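(* Let $h>0$, $a\in\mathbb{R}$, $\nu\in(0,1]$, let $y:(h\mathbb{N})_a\to\mathbb{R}$ satisfy $y(t)\ge0$ for all $t\in(h\mathbb{N})_a$, and let $l\in\{2k+1:k\in\mathbb{N},\,k\ge1\}$. Then $$({}_a\Delta_{h}^{\nu}y^{l})(t)\le l\,y^{l-1}(t+\nu h)\,({}_a\Delta_{h}^{\nu}y)(t),\qquad t\in(h\mathbb{N})_{a+(1-\nu)h}.$$
   Context: For $h>0$ and $a\in\mathbb{R}$, $(h\mathbb{N})_a=\{a,a+h,a+2h,\dots\}$, $\sigma(t)=t+h$, and $(\Delta_h y)(t)=\frac{y(t+h)-y(t)}{h}$. The $h$-factorial function is $t_h^{(\alpha)}=h^{\alpha}\frac{\Gamma(t/h+1)}{\Gamma(t/h+1-\alpha)}$, taken to be $0$ when $t/h+1-\alpha$ is a nonpositive integer and $t/h+1$ is not. For $\mu>0$ the fractional $h$-sum is $({}_a\Delta_h^{-\mu}y)(t)=\frac{h}{\Gamma(\mu)}\sum_{s=a/h}^{t/h-\mu}(t-\sigma(sh))_h^{(\mu-1)}y(sh)$ for $t\in(h\mathbb{N})_{a+\mu h}$, where $s$ runs over $a/h,a/h+1,\dots,t/h-\mu$ and $\sigma(sh)=(s+1)h$; and ${}_a\Delta_h^{0}y=y$. For $\nu\in(0,1]$ the Riemann–Liouville-like fractional $h$-difference is $({}_a\Delta_{h}^{\nu}y)(t)=(\Delta_h({}_a\Delta_h^{-(1-\nu)}y))(t)$, $t\in(h\mathbb{N})_{a+(1-\nu)h}$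 (so it equals $\Delta_h y$ if $\nu=1$). Here $y^{l}$ is the pointwise power and $y^{l-1}(t+\nu h)=(y(t+\nu h))^{l-1}$. *)

(* Defs.v *)
From HB Require Import structures.
From mathcomp Require Import all_boot all_order all_algebra.
From mathcomp Require Import all_classical all_reals all_analysis.

Set Implicit Arguments.
Unset Strict Implicit.
Unset Printing Implicit Defensive.

Import Order.TTheory GRing.Theory Num.Theory.
Import numFieldNormedType.Exports.

Local Open Scope classical_set_scope.
Local Open Scope ring_scope.

(* Euler's integral of the second kind; meaningful for 0 < x. *)
Definition euler_integral (R : realType) (x : R) : R :=
  \int[lebesgue_measure]_(u in `]0, +oo[) (u `^ (x - 1) * expR (- u)).

(* For x <= 0, gamma_shift x is the least n such that 0 < x + n. *)
Definition gamma_shift (R : realType) (x : R) : nat :=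
  if 0 < x then 0%N else (Num.truncn (- x)).+1.

(* Extension of Euler's integral to the whole line by
   Gamma x = Gamma (x + n) / (x (x + 1) ... (x + n - 1)).
   At the poles 0, -1, -2, ... one factor vanishes and the value is 0. *)
Definition Gamma (R : realType) (x : R) : R :=
  euler_integral (x + (gamma_shift x)%:R) /
  \prod_(i < gamma_shift x) (x + i%:R).

Definition nonpos_integer (R : realType) (x : R) : bool :=
  - x \is a Num.nat.

Definition hgrid (R : realType) (h a : R) : set R :=
  [set a + k%:R * h | k in [set: nat]].

Definition hsigma (R : realType) (h t : R) : R := t + h.

Definition hdelta (R : realType) (h : R) (y : R -> R) (t : R) : R :=
  (y (t + h) - y t) / h.

Definition hfactorial (R : realType) (h t alpha : R) : R :=
  if nonpos_integer (t / h + 1 - alpha) && ~~ nonpos_integer (t / h + 1)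
  then 0
  else h `^ alpha * (Gamma (t / h + 1) / Gamma (t / h + 1 - alpha)).

(* Functions on (hN)_a are represented by total functions on R: for t in the
   grid (hN)_(a + mu h), only the values of y on (hN)_a are used. *)
Definition fractional_hsum (R : realType) (h a mu : R) (y : R -> R) (t : R) :
    R :=
  if mu == 0 then y t
  else h / Gamma mu *
    \sum_(s \in [set s | hgrid 1 (a / h) s /\ s <= t / h - mu])
      (hfactorial h (t - hsigma h (s * h)) (mu - 1) * y (s * h)).

Definition fractional_hdiff (R : realType) (h a nu : R) (y : R -> R) : R -> R :=
  hdelta h (fractional_hsum h a (1 - nu) y).

(* Main.v *)
Require Import Defs.
From HB Require Import structures.
From mathcomp Require Import all_boot all_order all_algebra.
From mathcomp Require Import all_classical all_reals all_analysis.
From mathcomp Require Import measurable_realfun ring lra.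

Set Implicit Arguments.
Unset Strict Implicit.
Unset Printing Implicit Defensive.

Import Order.TTheory GRing.Theory Num.Theory.
Import numFieldNormedType.Exports.

Local Open Scope classical_set_scope.
Local Open Scope ring_scope.

(** On the grid point t = a + (1 - nu) h + n h, the fractional sum of order
    1 - nu is a discrete convolution sum_{k <= n} w_(n-k) y_k of the values
    y_k = y(a + k h) with a kernel w that does not depend on y.  All that
    matters about w is that it is nonnegative and nonincreasing
    ([fractional_hsum_conv]).  For mu = 1 - nu in ]0, 1[ it is a nonnegative
    multiple of Gamma(mu + j) / Gamma(j + 1), whose successive quotients
    (mu + j) / (j + 1) are at most 1; for nu = 1 it is the unit mass at 0.

    Since t + nu h = a + (n + 1) h, put Y = y_(n+1) and
    d_k = w_(n-k) - w_(n+1-k) >= 0.  The fractional difference of a function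
    z is, up to the factor 1 / h, equal to w_0 z_(n+1) - sum_{k <= n} d_k z_k.
    After insertion of z = y^l and z = y, the claim becomes
      sum_k d_k (l Y^(l-1) y_k - y_k^l) <= (l - 1) w_0 Y^l.
    The tangent line of x^l at Y lies below its graph ([expr_tangent]), so
    each bracket is at most (l - 1) Y^l, and the d_k telescope to
    w_0 - w_(n+1) <= w_0 ([expr_convolution_le]).

    The quotients of the kernel come from Gamma(x + 1) = x Gamma(x) for x > 0,
    that is, from an integration by parts in Euler's integral.  It is done on
    [1/N, N], where every function is smooth, and N goes to infinity: the
    integrals converge by monotonicity, the boundary terms vanish
    ([euler_integralD1]).  The kernel is nonnegative because Euler's integrand
    is. *)

(** * The functional equation of Gamma *)

Lemma euler_integral_ge0 (R : realType) (x : R) : 0 <= euler_integral x.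
Proof.
apply: fine_ge0; apply: integral_ge0 => u _.
by rewrite lee_fin mulr_ge0 ?powR_ge0 ?expR_ge0.
Qed.

Lemma continuous_powR (R : realType) (x u : R) :
  0 < u -> {for u, continuous (@powR R ^~ x)}.
Proof.
move=> u0; apply/differentiable_continuous/derivable1_diffP.
by apply: derivable_powR; rewrite in_itv/= u0.
Qed.

Lemma continuous_expRN (R : realType) : continuous (fun u : R => expR (- u)).
Proof.
move=> u; apply: continuous_comp; first exact: opp_continuous.
exact: continuous_expR.
Qed.

Lemma is_derive_oppexpRN (R : realType) (u : R) :
  is_derive u 1 (fun v : R => - expR (- v)) (expR (- u)).
Proof.
apply: is_derive_eq.
by rewrite mulrN1 opprK.
Qed.

Lemma measurable_gamma_integrand (R : realType) (x : R) (D : set R) :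
  measurable_fun D (fun u : R => (u `^ x * expR (- u))%:E).
Proof.
apply/measurable_EFinP/measurable_funTS; apply: measurable_funM.
  exact: measurable_powR.
by apply: continuous_measurable_fun; exact: continuous_expRN.
Qed.

(** The endpoint 0 is kept out because for x < 1 the factor u^(x-1) is
    singular there. *)
Lemma powR_by_parts (R : realType) (x a b : R) : 0 < x -> 0 < a -> a < b ->
  (x%:E * \int[lebesgue_measure]_(u in `[a, b])
      (u `^ (x - 1) * expR (- u))%:E =
   \int[lebesgue_measure]_(u in `[a, b]) (u `^ x * expR (- u))%:E +
   (b `^ x * expR (- b) - a `^ x * expR (- a))%:E)%E.
Proof.
move=> x0 a0 ab.
have pos u : u \in `[a, b] -> 0 < u.
  by rewrite in_itv/= => /andP[au _]; exact: lt_le_trans au.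
have posoo u : u \in `]a, b[ -> 0 < u.
  by rewrite in_itv/= => /andP[au _]; exact: lt_trans au.
have cN := @continuous_expRN R.
have b0 := lt_trans a0 ab.
rewrite (@integration_by_parts R (@powR R ^~ x) (fun u => - expR (- u))
  (fun u => x * u `^ (x - 1)) (fun u => expR (- u)))//.
- under [X in (_ - X)%E]eq_integral do rewrite mulrN EFinN -mulrA.
  rewrite integral_ge0N; last first.
    by move=> u _; rewrite lee_fin !mulr_ge0 ?powR_ge0 ?expR_ge0 ?ltW.
  under [X in (_ - - X)%E]eq_integral do rewrite EFinM.
  rewrite ge0_integralZl_EFin//; last 3 first.
  + by move=> u _; rewrite lee_fin mulr_ge0 ?powR_ge0 ?expR_ge0.
  + exact: measurable_gamma_integrand.
  + exact: ltW.
  rewrite oppeK addeAC -EFinD -[LHS]add0e; congr (_%:E + _)%E.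
  by rewrite !mulrN opprK; lra.
- apply: continuous_in_subspaceT => u; rewrite inE => /pos u0.
  by apply: cvgM; [exact: cvg_cst|exact: continuous_powR].
- split.
  + by move=> u /posoo u0; apply: derivable_powR; rewrite in_itv/= u0.
  + exact/cvg_at_right_filter/continuous_powR.
  + exact/cvg_at_left_filter/continuous_powR.
- by move=> u /posoo u0; rewrite powR_derive1// in_itv/= u0.
- by apply: continuous_in_subspaceT => u _; exact: cN.
- split.
  + by move=> u _; apply: ex_derive; exact: is_derive_oppexpRN.
  + by apply: cvg_at_right_filter; apply: cvgN; exact: cN.
  + by apply: cvg_at_left_filter; apply: cvgN; exact: cN.
- by move=> u _; rewrite derive1E; have [_ ->] := is_derive_oppexpRN u.
Qed.

(** Raising e^(u/2x) >= u/2x to the power 2x gives e^u >= (u/2x)^(2x), which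
    beats u^x by a factor u^x.  The bound is a multiple of (1/u)^x so that the
    behaviour at infinity reduces to the limit of v^x at 0. *)
Lemma powR_expRN_le (R : realType) (x u : R) : 0 < x -> 0 < u ->
  u `^ x * expR (- u) <= (2 * x) `^ (2 * x) * u^-1 `^ x.
Proof.
move=> x0 u0.
have c0 : 0 < 2 * x by rewrite mulr_gt0.
have uc0 : 0 <= u / (2 * x) by rewrite ltW ?divr_gt0.
have le1 : (u / (2 * x)) `^ (2 * x) <= expR u.
  rewrite -[in leRHS](divfK (lt0r_neq0 c0) u) expRM.
  rewrite ge0_ler_powR ?nnegrE ?expR_ge0 ?(ltW c0)//.
  by apply: le_trans (expR_ge1Dx _); rewrite lerDr.
have cp : 0 < (2 * x) `^ (2 * x) by rewrite powR_gt0.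
rewrite expRN ler_pdivrMr ?expR_gt0//.
apply: le_trans (ler_wpM2l _ le1); last first.
  by rewrite mulr_ge0 ?powR_ge0.
have -> : (u / (2 * x)) `^ (2 * x) = u `^ (2 * x) / (2 * x) `^ (2 * x).
  rewrite powRM ?invr_ge0 ?(ltW u0) ?(ltW c0)// -(powR_inv1 (ltW c0)).
  by rewrite -powRrM mulN1r powRN.
rewrite mulrAC (mulrC (u `^ _)) mulVKf ?gt_eqF//.
rewrite -(powR_inv1 (ltW u0)) -powRrM -powRD ?(gt_eqF u0) ?implybT//.
by rewrite le_eqVlt; apply/orP; left; apply/eqP; congr (_ `^ _); lra.
Qed.


Lemma bigcup_itv_invS (R : realType) :
  \bigcup_n `[(n.+2%:R : R)^-1, n.+2%:R]%classic = `]0, +oo[%classic.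
Proof.
apply/seteqP; split=> [u [n _]|u]; rewrite /= !in_itv/=.
  by case/andP=> nu _; rewrite andbT (lt_le_trans _ nu).
rewrite andbT => u0.
(* This index makes both u and 1/u at most m + 2. *)
set m := Num.truncn (Num.max u u^-1).
have um : Num.max u u^-1 <= m.+2%:R.
  have := truncnS_gt (Num.max u u^-1); rewrite -/m => /ltW/le_trans; apply.
  by rewrite ler_nat.
exists m => //; rewrite /= in_itv/=; move: um; rewrite ge_max => /andP[-> um].
by rewrite andbT invf_ple ?posrE.
Qed.

(** Monotone convergence along the exhaustion of ]0, +oo[ by the intervals
    [1/(n+2), n+2]; the shift by 2 makes each of them nondegenerate. *)
Lemma cvgn_integral_itv_invS (R : realType) (f : R -> R) :
  measurable_fun [set: R] (fun u => (f u)%:E) ->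
  (forall u, 0 < u -> 0 <= f u) ->
  (\int[lebesgue_measure]_(u in `[n.+2%:R^-1%R, n.+2%:R%R]) (f u)%:E)%E
    @[n --> \oo] -->
  (\int[lebesgue_measure]_(u in `]0%R, +oo[) (f u)%:E)%E.
Proof.
move=> mf f0; rewrite -bigcup_itv_invS.
apply: ge0_nondecreasing_set_cvg_integral.
- apply/nondecreasing_seqP => n; apply/subsetPset => u /=.
  rewrite !in_itv/= => /andP[nu un]; apply/andP; split.
    by apply: le_trans nu; rewrite lef_pV2 ?posrE// ler_nat.
  by apply: le_trans un _; rewrite ler_nat.
- by [].
- by move=> n; exact: measurable_funTS.
- move=> n u /=; rewrite in_itv/= lee_fin => /andP[nu _].
  by apply: f0; rewrite (lt_le_trans _ nu).
Qed.

Lemma cvgn_gamma_boundary (R : realType) (x : R) : 0 < x ->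
  n.+2%:R `^ x * expR (- n.+2%:R) - n.+2%:R^-1 `^ x * expR (- n.+2%:R^-1)
    @[n --> \oo] --> (0 : R).
Proof.
move=> x0; set C : R := (2 * x) `^ (2 * x).
have av0 : (n.+2%:R^-1 : R) `^ x @[n --> \oo] --> (0 : R).
  have /cvg_at_rightP := powR_cvg0 x0; apply; split=> [n|]; first by [].
  by rewrite (cvg_shiftS (@harmonic R)); exact: cvg_harmonic.
have Cav0 : (C + 1) * (n.+2%:R^-1 : R) `^ x @[n --> \oo] --> (0 : R).
  by rewrite -(mulr0 (C + 1)); apply: cvgM => //; exact: cvg_cst.
apply: (squeeze_cvgr _ _ Cav0); last first.
  by rewrite -oppr0; apply: cvgN Cav0.
apply: nearW => n; rewrite -ler_norml.
have := powR_expRN_le x0 (ltr0Sn R n.+1); rewrite -/C => bC.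
have e1 : expR (- n.+2%:R^-1) <= 1 :> R by rewrite expR_le1 oppr_le0.
apply: le_trans (ler_normB _ _) _.
rewrite !ger0_norm ?mulr_ge0 ?powR_ge0 ?expR_ge0// mulrDl mul1r lerD//.
by rewrite ler_piMr ?powR_ge0.
Qed.

(** The identity is first obtained between extended reals, where it holds even
    if an integral is infinite.  Passing to real values sends both infinities
    to 0, so the case +oo = x * +oo becomes 0 = x * 0. *)
Lemma euler_integralD1 (R : realType) (x : R) : 0 < x ->
  euler_integral (x + 1) = x * euler_integral x.
Proof.
move=> x0; rewrite /euler_integral /Rintegral addrK.
(* B and A are the extended real integrals for x + 1 and x. *)
set B := (\int[_]_(_ in _) _)%E; set A := (\int[_]_(_ in _) _)%E.
suff -> : B = (x%:E * A)%E.
  case: A => [//| |].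
  - by rewrite gt0_muley ?lte_fin//= mulr0.
  - by rewrite gt0_muleNy ?lte_fin//= mulr0.
have lim (p : R) : (\int[lebesgue_measure]_(u in `[n.+2%:R^-1%R, n.+2%:R%R])
      (u `^ p * expR (- u))%:E)%E @[n --> \oo] -->
    (\int[lebesgue_measure]_(u in `]0%R, +oo[) (u `^ p * expR (- u))%:E)%E.
  apply: cvgn_integral_itv_invS => [|u u0].
    exact: measurable_gamma_integrand.
  by rewrite mulr_ge0 ?powR_ge0 ?expR_ge0.
have limA := cvgeZl (isT : x%:E \is a fin_num) (lim (x - 1)).
have limE : (n.+2%:R `^ x * expR (- n.+2%:R)
    - n.+2%:R^-1 `^ x * expR (- n.+2%:R^-1))%:E @[n --> \oo] --> (0 : R)%:E.
  by apply: cvg_EFin; [exact: nearW|exact: cvgn_gamma_boundary].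
have limB := cvgeD (fin_num_adde_defl _ (isT : (0 : R)%:E \is a fin_num))
  (lim x) limE.
rewrite -[LHS]adde0 -(cvg_lim (@ereal_hausdorff R) (limB _)).
rewrite -(cvg_lim (@ereal_hausdorff R) limA).
apply/congr_lim/funext => n.
rewrite powR_by_parts// ?invr_gt0 ?ltr0Sn//.
by rewrite (@lt_trans _ _ 1) ?invf_lt1 ?ltr1n ?ltr0Sn.
Qed.

Lemma GammaE (R : realType) (x : R) : 0 < x -> Gamma x = euler_integral x.
Proof.
by move=> x0; rewrite /Gamma /gamma_shift x0 addr0 big_ord0 divr1.
Qed.

Lemma Gamma_ge0 (R : realType) (x : R) : 0 < x -> 0 <= Gamma x.
Proof. by move=> x0; rewrite GammaE ?euler_integral_ge0. Qed.

Lemma GammaD1 (R : realType) (x : R) : 0 < x -> Gamma (x + 1) = x * Gamma x.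
Proof. by move=> x0; rewrite !GammaE ?euler_integralD1 ?addr_gt0. Qed.

(** * The fractional sum as a convolution *)

Definition gamma_ratio (R : realType) (mu : R) (j : nat) : R :=
  Gamma (mu + j%:R) / Gamma j.+1%:R.

Lemma gamma_ratio_ge0 (R : realType) (mu : R) j :
  0 < mu -> 0 <= gamma_ratio mu j.
Proof.
by move=> mu0; rewrite divr_ge0 ?Gamma_ge0 ?ltr0Sn ?ltr_wpDr.
Qed.

Lemma gamma_ratioS (R : realType) (mu : R) j : 0 < mu ->
  gamma_ratio mu j.+1 = (mu + j%:R) / j.+1%:R * gamma_ratio mu j.
Proof.
move=> mu0; rewrite /gamma_ratio -(natr1 j) addrA GammaD1 ?ltr_wpDr//.
by rewrite natr1 -(natr1 j.+1) GammaD1 ?ltr0Sn// invfM mulrACA.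
Qed.

Lemma gamma_ratio_noninc (R : realType) (mu : R) j : 0 < mu -> mu <= 1 ->
  gamma_ratio mu j.+1 <= gamma_ratio mu j.
Proof.
move=> mu0 mu1; rewrite gamma_ratioS// ler_piMl ?gamma_ratio_ge0//.
by rewrite ler_pdivrMr ?ltr0Sn// mul1r -nat1r lerD2r.
Qed.

Lemma fractional_hsum_support (R : realType) (a : R) (n : nat) :
  [set s | hgrid 1 a s /\ s <= a + n%:R] =
  [set a + k%:R | k in `I_n.+1].
Proof.
apply/seteqP; split=> [s [[k _ <-]]|_ [k kn <-]] /=.
  by rewrite mulr1 lerD2l ler_nat => kn; exists k.
split; last by rewrite lerD2l ler_nat.
by exists k => //; rewrite mulr1.
Qed.

(** With t = (mu + j - 1) h, the denominator argument t/h + 1 - (mu - 1) is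
    j + 1 > 0, so the exceptional zero branch of the h-factorial is never
    taken. *)
Lemma hfactorial_gamma_ratio (R : realType) (h mu : R) (j : nat) : 0 < h ->
  hfactorial h ((mu + j%:R - 1) * h) (mu - 1) =
  h `^ (mu - 1) * gamma_ratio mu j.
Proof.
move=> h0; rewrite /hfactorial mulfK ?gt_eqF// subrK.
have -> : mu + j%:R - (mu - 1) = j.+1%:R by rewrite -natr1; lra.
case: ifPn => // /andP[+ _]; rewrite /nonpos_integer => /natrP[m mE].
have := ltr0Sn R j; rewrite -oppr_lt0 mE.
by rewrite ltNge ler0n.
Qed.

Lemma fractional_hsumE (R : realType) (h a mu : R) (y : R -> R) (n : nat) :
  0 < h -> 0 < mu ->
  fractional_hsum h a mu y (a + mu * h + n%:R * h) =
  h `^ mu / Gamma mu *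
    \sum_(k < n.+1) gamma_ratio mu (n - k) * y (a + k%:R * h).
Proof.
move=> h0 mu0; have hn0 : h != 0 by rewrite gt_eqF.
rewrite /fractional_hsum gt_eqF//.
have -> : (a + mu * h + n%:R * h) / h - mu = a / h + n%:R.
  by rewrite !mulrDl !mulfK//; lra.
rewrite fractional_hsum_support fsbig_image; last first.
  by move=> i j _ _ /addrI/eqP; rewrite eqr_nat => /eqP.
rewrite -fsbig_ord !mulr_sumr; apply: eq_bigr => k _; have kn := ltn_ord k.
have -> : a + mu * h + n%:R * h - hsigma h ((a / h + k%:R) * h) =
    (mu + (n - k)%:R - 1) * h.
  have kn' : (k <= n)%N by [].
  rewrite /hsigma (natrB _ kn') (mulrDl (a / h)) divfK//.
  ring.
rewrite hfactorial_gamma_ratio// [(a / h + _) * h]mulrDl divfK//.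
by rewrite -(mulr_powRB1 (ltW h0) mu0); ring.
Qed.

(** This is the only information on the fractional sum that the inequality
    needs, and it also covers the order mu = 0, where the sum degenerates to
    the identity. *)
Lemma fractional_hsum_conv (R : realType) (h a mu : R) :
  0 < h -> 0 <= mu -> mu < 1 ->
  exists w : nat -> R, [/\ forall j, 0 <= w j, forall j, w j.+1 <= w j &
    forall (y : R -> R) n, fractional_hsum h a mu y (a + mu * h + n%:R * h) =
      \sum_(k < n.+1) w (n - k)%N * y (a + k%:R * h)].
Proof.
move=> h0; rewrite le_eqVlt => /predU1P[<- _|mu0 mu1].
  (* The unit mass at 0 is the unit of convolution. *)
  exists (fun j => (j == 0)%:R); split=> // y n.
  rewrite /fractional_hsum eqxx mul0r addr0 big_ord_recr/= subnn eqxx mul1r.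
  rewrite big1 ?add0r// => k _.
  by rewrite subn_eq0 leqNgt ltn_ord mul0r.
have C0 : 0 <= h `^ mu / Gamma mu by rewrite divr_ge0 ?powR_ge0 ?Gamma_ge0.
exists (fun j => h `^ mu / Gamma mu * gamma_ratio mu j); split=> [j|j|y n].
- by rewrite mulr_ge0 ?gamma_ratio_ge0.
- by rewrite ler_wpM2l ?gamma_ratio_noninc ?(ltW mu1).
- rewrite fractional_hsumE// mulr_sumr.
  by apply: eq_bigr => k _; rewrite mulrA.
Qed.

(** * The convexity inequality *)

(** The tangent line inequality for the (m+1)-st power at y, with negative
    terms moved across.  In the induction step the two sides differ by y times
    the previous difference plus (x^(m+1) - y^(m+1)) (x - y), which is
    nonnegative because powers are increasing. *)
Lemma expr_tangent (R : realDomainType) (x y : R) m : 0 <= x -> 0 <= y ->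
  m.+1%:R * y ^+ m * x <= x ^+ m.+1 + m%:R * y ^+ m.+1.
Proof.
move=> x0 y0; elim: m => [|m IH].
  by rewrite expr0 !mul1r mul0r addr0.
have cross : 0 <= (x ^+ m.+1 - y ^+ m.+1) * (x - y).
  have [xy|/ltW yx] := leP x y.
    by rewrite mulr_le0 ?subr_le0// lerXn2r.
  by rewrite mulr_ge0 ?subr_ge0// lerXn2r.
move: IH; rewrite -subr_ge0 => IH; rewrite -subr_ge0.
have := addr_ge0 (mulr_ge0 y0 IH) cross.
congr (0 <= _); rewrite -!natr1 !exprS; ring.
Qed.

(** The difference of two successive convolutions puts the weight w_0 on the
    newest value and total negative weight at most w_0 on the older ones;
    this balance lets the pointwise tangent inequalities add up. *)
Lemma expr_convolution_le (R : realDomainType) (w y : nat -> R) n m :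
  (forall j, 0 <= w j) -> (forall j, w j.+1 <= w j) -> (forall j, 0 <= y j) ->
  \sum_(k < n.+2) w (n.+1 - k)%N * y k ^+ m.+1
    - \sum_(k < n.+1) w (n - k)%N * y k ^+ m.+1 <=
  m.+1%:R * y n.+1 ^+ m *
    (\sum_(k < n.+2) w (n.+1 - k)%N * y k
     - \sum_(k < n.+1) w (n - k)%N * y k).
Proof.
move=> w0 wS y0; set Y := y n.+1; have Y0 : 0 <= Y by exact: y0.
pose d (k : 'I_n.+1) := w (n - k)%N - w (n.+1 - k)%N.
have d0 k : 0 <= d k by rewrite /d subr_ge0 subSn ?wS// -ltnS.
have dE (z : nat -> R) : \sum_(k < n.+2) w (n.+1 - k)%N * z k
    - \sum_(k < n.+1) w (n - k)%N * z k =
    w 0%N * z n.+1 - \sum_(k < n.+1) d k * z k.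
  rewrite big_ord_recr/= subnn addrAC -sumrB addrC -[in RHS]sumrN.
  by congr (_ + _); apply: eq_bigr => k _; rewrite /d; ring.
rewrite (dE (fun k => y k ^+ m.+1)) dE -/Y.
(* Inserting the constant function 1 in dE telescopes the sum of the d k. *)
have sd : \sum_k d k <= w 0%N.
  have := dE (fun=> 1); rewrite big_ord_recl/= subn0 !mulr1.
  under [in X in _ + X - _]eq_bigr do rewrite subSS.
  rewrite addrK; under eq_bigr do rewrite mulr1.
  by move=> wE; rewrite -subr_ge0 -wE.
have Ym : 0 <= m%:R * Y ^+ m.+1 by rewrite mulr_ge0// exprn_ge0.
have tangents : \sum_k d k * (m.+1%:R * Y ^+ m * y k) <=
    \sum_k d k * y k ^+ m.+1 + (\sum_k d k) * (m%:R * Y ^+ m.+1).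
  rewrite mulr_suml -big_split/=; apply: ler_sum => k _.
  by rewrite -mulrDr ler_wpM2l// expr_tangent.
have := ler_wpM2r Ym sd; move: tangents.
under eq_bigr do rewrite mulrCA.
rewrite -mulr_sumr; move: (\sum_k d k * y k) (\sum_k d k * y k ^+ m.+1).
rewrite exprS -natr1; move: (Y ^+ m) (\sum_k d k) => P D S T.
by rewrite mulrA; lra.
Qed.

Theorem proposition4p4 (R : realType) (h a nu : R) (y : R -> R) (l : nat)
  (h_gt0 : 0 < h) (nu_gt0 : 0 < nu) (nu_le1 : nu <= 1)
  (y_ge0 : forall t : R, hgrid h a t -> 0 <= y t)
  (l_odd : exists2 k : nat, (1 <= k)%N & l = (2 * k + 1)%N) :
  forall t : R, hgrid h (a + (1 - nu) * h) t ->
    fractional_hdiff h a nu (fun s => y s ^+ l) t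
      <= l%:R * y (t + nu * h) ^+ (l - 1) * fractional_hdiff h a nu y t.
Proof.
case: l_odd => k _ -> _ [n _ <-]; rewrite addnK addn1.
have mu0 : 0 <= 1 - nu by rewrite subr_ge0.
have mu1 : 1 - nu < 1 by rewrite ltrBlDr ltrDl.
have [w [w0 wS wE]] := fractional_hsum_conv a h_gt0 mu0 mu1.
have diffE z : fractional_hdiff h a nu z (a + (1 - nu) * h + n%:R * h) =
    (\sum_(k < n.+2) w (n.+1 - k)%N * z (a + k%:R * h)
     - \sum_(k < n.+1) w (n - k)%N * z (a + k%:R * h)) / h.
  rewrite /fractional_hdiff /hdelta -(wE z n.+1) -(wE z n).
  by rewrite -(natr1 n) (mulrDl n%:R) mul1r addrA.
have -> : a + (1 - nu) * h + n%:R * h + nu * h = a + n.+1%:R * h.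
  by rewrite -natr1; ring.
rewrite !diffE mulrA ler_wpM2r ?invr_ge0 ?(ltW h_gt0)//.
apply: (@expr_convolution_le _ w (fun k => y (a + k%:R * h))) => // j.
by apply: y_ge0; exists j.
Qed.
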